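(* Let $X,Y$ be metric spaces, let $\pi:X\to Y$ be a linear and quotient map, and let $\varphi:Y\to X$ be a section of $\pi$. Then the map $y\mapsto Ils_a(\varphi)(y)$ is upper semicontinuous with respect to the metric topology of $Y$, i.e. $$\limsup_{z\to y} Ils_a(\varphi)(z)\le Ils_a(\varphi)(y),\qquad\forall y\in Y.$$
   Context: $X$ and $Y$ carry real vector space structures for which $\pi$ is linear. $d$ is the distance on $X$ and $d(x,A)=\inf_{a\in A}d(x,a)$. A quotient map is a continuous, open, surjective map. A section of $\pi$ is a map $\varphi:Y\to X$ with $\pi\circ\varphi=\mathrm{id}_Y$. The asymptotic intrinsically Lipschitz constant of $\varphi$ is $$Ils_a(\varphi)(z)=\limsup_{y_1,y_2\to z,\ y_1\neq y_2}\frac{d(\varphi(y_1),\varphi(y_2))}{d(\varphi(y_1),\pi^{-1}(y_2))}=\inf_{\varepsilon>0}\ \sup_{y_1,y_2\in B(z,\varepsilon),\ y_1\ne y_2}\frac{d(\varphi(y_1),\varphi(y_2))}{d(\varphi(y_1),\pi^{-1}(y_2))}$$ (an extended real number) if $z$ is an accumulation point of $Y$, and $Ils_a(\varphi)(z)=0$ otherwise. *)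

(* Defs.v *)
From HB Require Import structures.
From mathcomp Require Import all_boot all_order all_algebra.
From mathcomp Require Import all_classical all_reals.
From mathcomp Require Import topology ereal ereal_normedtype.

Set Implicit Arguments.
Unset Strict Implicit.
Unset Printing Implicit Defensive.

Import Order.TTheory GRing.Theory Num.Theory.

Local Open Scope classical_set_scope.
Local Open Scope ring_scope.

(* A metric space whose carrier is also a vector space; no compatibility between
   the metric and the linear structure is required.  HB rejects this join once
   the normed structures are loaded, hence the restricted imports. *)
#[short(type="metricLmodType")]
HB.structure Definition MetricLmodule (R : numFieldType) :=
  { M of Metric R M & GRing.Lmodule R M }.

Definition quotient_map (X Y : topologicalType) (f : X -> Y) : Prop :=
  [/\ continuous f,
      forall U : set X, open U -> open (f @` U) &
      range f = [set: Y]].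

Section intrinsically_lipschitz.
Context {R : realType}.

Definition dist_set (X : metricType R) (x : X) (A : set X) : R :=
  inf [set mdist x a | a in A].

Context {X Y : metricType R}.

Definition Ils_ratio (pi : X -> Y) (phi : Y -> X) (y1 y2 : Y) : R :=
  mdist (phi y1) (phi y2) / dist_set (phi y1) (pi @^-1` [set y2]).

(* If pi is continuous and phi is a section of pi, then for y1 != y2 the fiber
   over y2 is nonempty, closed and misses phi y1, so the infimum is genuine and
   the denominator is positive: the conventions inf set0 = 0 and x / 0 = 0 never
   apply. *)
Definition Ils_a (pi : X -> Y) (phi : Y -> X) (z : Y) : \bar R :=
  if `[< limit_point [set: Y] z >] then
    ereal_inf
      [set ereal_sup
             [set (Ils_ratio pi phi p.1 p.2)%:E
             | p in [set p : Y * Y |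
                      [/\ ball z eps p.1, ball z eps p.2 & p.1 != p.2]]]
      | eps in [set eps : R | 0 < eps]]
  else 0%E.

End intrinsically_lipschitz.

(* Main.v *)
(* If B(z, eps/2) is contained in B(y, eps), the supremum defining the constant
   at z is dominated by the one over B(y, eps); taking the infimum over eps gives
   the claim. At an isolated z the constant is 0, which is dominated as well
   because the ratios are nonnegative and, when y is an accumulation point,
   B(y, eps) contains a pair of distinct points. If y itself is isolated, then
   {y} is a neighbourhood of y. *)

Require Import Defs.
From HB Require Import structures.
From mathcomp Require Import all_boot all_order all_algebra.
From mathcomp Require Import all_classical all_reals.
From mathcomp Require Import topology ereal ereal_normedtype.

Import Order.TTheory GRing.Theory Num.Theory.

Local Open Scope classical_set_scope.
Local Open Scope ring_scope.

Lemma dist_set_ge0 {R : realType} {X : metricType R} (x : X) (A : set X) :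
  0 <= dist_set x A.
Proof.
rewrite /dist_set; have [->|/set0P A0] := eqVneq A set0.
  (* The empty set needs its own case: its [inf] is the default value 0. *)
  by rewrite image_set0 inf0.
by apply: lb_le_inf; [exact: image_nonempty|move=> _ [a _ <-]; exact: mdist_ge0].
Qed.

Section intrinsically_lipschitz_theory.
Context {R : realType} {X Y : metricType R} (pi : X -> Y) (phi : Y -> X).

Lemma Ils_ratio_ge0 (y1 y2 : Y) : 0 <= Ils_ratio pi phi y1 y2.
Proof. by apply: divr_ge0; [exact: mdist_ge0|exact: dist_set_ge0]. Qed.

Definition Ils_sup (z : Y) (eps : R) : \bar R :=
  ereal_sup [set (Ils_ratio pi phi p.1 p.2)%:E
            | p in [set p : Y * Y |
                     [/\ ball z eps p.1, ball z eps p.2 & p.1 != p.2]]].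

Lemma Ils_a_limit_point (z : Y) : limit_point [set: Y] z ->
  Ils_a pi phi z = ereal_inf [set Ils_sup z eps | eps in [set eps : R | 0 < eps]].
Proof. by move=> zlim; rewrite /Ils_a asboolT. Qed.

Lemma Ils_a_isolated (z : Y) : ~ limit_point [set: Y] z -> Ils_a pi phi z = 0%E.
Proof. by move=> zlim; rewrite /Ils_a asboolF. Qed.

Lemma Ils_sup_subset (y z : Y) (e d : R) :
  ball z d `<=` ball y e -> (Ils_sup z d <= Ils_sup y e)%E.
Proof.
move=> zy; apply: ereal_sup_le => _ [p [p1 p2 p12] <-]; exists p => //.
by split => //; exact: zy.
Qed.

(** Over an empty set of pairs the supremum would be -oo; the accumulation point [y] supplies a pair
    [(x, y)] of distinct points. *)
Lemma Ils_sup_ge0 (y : Y) (e : R) : 0 < e -> limit_point [set: Y] y ->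
  (0 <= Ils_sup y e)%E.
Proof.
move=> e0 /(_ _ (nbhsx_ballx y _ e0))[x [xy _ yex]].
apply: le_ereal_sup_tmp; exists (Ils_ratio pi phi x y)%:E.
  by exists (x, y) => //; split => //; exact: ballxx.
by rewrite lee_fin Ils_ratio_ge0.
Qed.

(** Treats both branches of [Ils_a] at [z], so that the limsup bound only splits on [y]. *)
Lemma Ils_a_le_sup (y z : Y) (e d : R) : 0 < e -> 0 < d ->
  limit_point [set: Y] y -> ball z d `<=` ball y e ->
  (Ils_a pi phi z <= Ils_sup y e)%E.
Proof.
move=> e0 d0 ylim zy; have [zlim|zlim] := pselect (limit_point [set: Y] z).
- rewrite Ils_a_limit_point //; apply: le_trans (Ils_sup_subset _ _ _ _ zy).
  by apply: ereal_inf_lbound; exists d.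
- by rewrite Ils_a_isolated //; exact: Ils_sup_ge0.
Qed.

Lemma limf_esup_Ils_a (y : Y) :
  (limf_esup (Ils_a pi phi) (nbhs y) <= Ils_a pi phi y)%E.
Proof.
rewrite limf_esupE; have [ylim|ynlim] := pselect (limit_point [set: Y] y).
- rewrite [leRHS]Ils_a_limit_point //; apply: le_ereal_inf_tmp => _ [e /= e0 <-].
  (* For [z] within [e / 2] of [y], the triangle inequality puts the ball of radius [e / 2] about
     [z] inside [ball y e]. *)
  have e20 : 0 < e / 2 by exact: divr_gt0.
  apply: (@le_trans _ _ (ereal_sup (Ils_a pi phi @` ball y (e / 2)))).
    by apply: ereal_inf_lbound; exists (ball y (e / 2)) => //; exact: nbhsx_ballx.
  apply: ge_ereal_sup => _ [z yz <-].
  apply: (Ils_a_le_sup _ _ _ _ e0 e20 ylim) => x zx.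
  by rewrite [e]splitr; exact: ball_triangle yz zx.
- have [U yU Uy] : exists2 U, nbhs y U & U `<=` [set y].
    move/existsNP: ynlim => [U /not_implyP[yU noU]]; exists U => // x Ux /=.
    by apply/eqP; apply: contra_notT noU => xy; exists x.
  apply: (@le_trans _ _ (ereal_sup (Ils_a pi phi @` U))).
    by apply: ereal_inf_lbound; exists U.
  (* The filter [nbhs y] is not punctured: on [U] the only value of [Ils_a] is the one at [y]. *)
  by apply: ge_ereal_sup => _ [z /Uy -> <-].
Qed.

End intrinsically_lipschitz_theory.

Theorem proposition3p5 (R : realType) (X Y : metricLmodType R)
    (pi : {linear X -> Y}) (hpi : quotient_map pi)
    (phi : Y -> X) (hphi : cancel phi pi) :
  forall y : Y,
    (limf_esup (Ils_a pi phi) (nbhs y) <= Ils_a pi phi y)%E.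
Proof. by move=> y; exact: limf_esup_Ils_a. Qed.
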